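(* Let $\alpha_1,\alpha_2,\beta_1,\beta_2>0$, let $\{X(t):t\geq 0\}$ be the continuous-time Markov chain on $\mathbb{Z}$ with alternating rates described in the context, and let $\Lambda$, $h$, $c_k$ be as in the context. For all $k\in\mathbb{Z}$ and $t\geq 0$, $$\mathbb{E}[X(t)|X(0)=k]=k+\Lambda'(0)t+\left.\left(\frac{c_k(z)}{h(z)}\right)'\right|_{z=1}\frac{1-e^{-(\alpha_1+\alpha_2+\beta_1+\beta_2)t}}{2},$$ where $$\left.\left(\frac{c_k(z)}{h(z)}\right)'\right|_{z=1}=\begin{cases}\frac{2(\alpha_1+\alpha_2)(\alpha_1-\alpha_2-\beta_1+\beta_2)}{(\alpha_1+\alpha_2+\beta_1+\beta_2)^2}&\text{if } k\text{ is even},\\ \frac{2(\beta_1+\beta_2)(\beta_1-\beta_2-\alpha_1+\alpha_2)}{(\alpha_1+\alpha_2+\beta_1+\beta_2)^2}&\text{if } k\text{ is odd}.\end{cases}$$ Moreover, if $k$ is even, $$\begin{aligned} \mathrm{Var}[X(t)|X(0)=k]={}&\Lambda''(0)t-e^{-2(\alpha_1+\alpha_2+\beta_1+\beta_2)t}\frac{(\alpha_1+\alpha_2)^2(\alpha_1-\alpha_2-\beta_1+\beta_2)^2}{(\alpha_1+\alpha_2+\beta_1+\beta_2)^4}\\ &+\frac{e^{-(\alpha_1+\alpha_2+\beta_1+\beta_2)t}}{(\alpha_1+\alpha_2+\beta_1+\beta_2)^3}\Big\{8t(\alpha_1+\alpha_2)(\alpha_1-\alpha_2-\beta_1+\beta_2)(\alpha_1\beta_1-\alpha_2\beta_2)\\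 &\quad+(\alpha_1+\alpha_2)(\alpha_1-\alpha_2-\beta_1+\beta_2)(\alpha_1+\alpha_2-\beta_1-\beta_2)\\ &\quad-6(\alpha_2-\beta_1)(\alpha_1-\alpha_2-\beta_1+\beta_2)(\alpha_1+\alpha_2-\beta_1-\beta_2)\\ &\quad-2(7\alpha_2+\beta_1-2\beta_2)(\beta_1+\beta_2)(\alpha_1+\alpha_2-\beta_1-\beta_2)\\ &\quad-4(\alpha_2-\beta_2)^2(\alpha_1+\alpha_2-\beta_1-\beta_2)+8\alpha_2(\beta_1+\beta_2)(\alpha_1+\alpha_2)\\ &\quad-8\alpha_2(\beta_1+\beta_2)(\alpha_1-\alpha_2-\beta_1+\beta_2)+8\beta_1(\beta_1+\beta_2)^2-\frac{16(\alpha_2+\beta_1)^2(\beta_1+\beta_2)^2}{\alpha_1+\alpha_2+\beta_1+\beta_2}\Big\}\\ &+\frac{1}{(\alpha_1+\alpha_2+\beta_1+\beta_2)^3}\Big\{(-7\alpha_1+3\alpha_2+10\beta_1-4\beta_2)(\beta_1+\beta_2)(\alpha_1-\alpha_2-\beta_1+\beta_2)\\ &\quad+4(\alpha_2+\alpha_1)(\alpha_2+2\beta_2)(\alpha_1-\alpha_2-\beta_1+\beta_2)+4(\alpha_2-\beta_2)^2(\alpha_1-\alpha_2-\beta_1+\beta_2)\\ &\quad+4(\alpha_2-\beta_2)(\alpha_2+\beta_1)(\beta_1+\beta_2)-10(\alpha_2+\beta_1)(\beta_1+\beta_2)^2+8(\alpha_2+\beta_1)(\alpha_2-\beta_2)^2\Big\}\\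 &+\frac{20(\alpha_2+\beta_1)^2(\beta_1+\beta_2)^2}{(\alpha_1+\alpha_2+\beta_1+\beta_2)^4}. \end{aligned}$$ Finally, if $k$ is odd, $\mathrm{Var}[X(t)|X(0)=k]$ is obtained by exchanging $(\alpha_1,\alpha_2)$ and $(\beta_1,\beta_2)$ (i.e. $\alpha_1\leftrightarrow\beta_1$, $\alpha_2\leftrightarrow\beta_2$) in the last expression (the value $\Lambda''(0)$ does not change under this exchange).
   Context: $\{X(t):t\geq 0\}$ is the continuous-time Markov chain on $\mathbb{Z}$ whose state probabilities $p_{k,n}(t):=P(X(t)=n|X(0)=k)$ satisfy $p_{k,n}(0)=1_{\{k=n\}}$ and whose generator $g_{k,n}:=\lim_{t\to 0}\frac{p_{k,n}(t)-p_{k,n}(0)}{t}$ is as follows. For even $k$: $g_{k,k+1}=\alpha_1$, $g_{k,k-1}=\alpha_2$, $g_{k,k}=-(\alpha_1+\alpha_2)$. For odd $k$: $g_{k,k+1}=\beta_1$, $g_{k,k-1}=\beta_2$, $g_{k,k}=-(\beta_1+\beta_2)$. All other entries are $0$. Functions used: for $z>0$, $$h(z):=\frac12\sqrt{(\alpha_1+\alpha_2-(\beta_1+\beta_2))^2z^2+4(\beta_1z^2+\beta_2)(\alpha_1z^2+\alpha_2)};$$ for $\gamma\in\mathbb{R}$, $$\Lambda(\gamma):=\frac{h(e^\gamma)}{e^\gamma}-\frac{\alpha_1+\alpha_2+\beta_1+\beta_2}{2};$$ and $c_k(z):=\frac{(\beta_1+\beta_2-(\alpha_1+\alpha_2))z}{2}+\alpha_1z^2+\alpha_2$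 if $k$ is even, $c_k(z):=\frac{(\alpha_1+\alpha_2-(\beta_1+\beta_2))z}{2}+\beta_1z^2+\beta_2$ if $k$ is odd. The derivatives of $\Lambda$ at the origin are $$\Lambda'(0)=\frac{2(\alpha_1\beta_1-\alpha_2\beta_2)}{\alpha_1+\alpha_2+\beta_1+\beta_2},\qquad \Lambda''(0)=\frac{4(\alpha_1\beta_1+\alpha_2\beta_2)}{\alpha_1+\alpha_2+\beta_1+\beta_2}-\frac{8(\alpha_1\beta_1-\alpha_2\beta_2)^2}{(\alpha_1+\alpha_2+\beta_1+\beta_2)^3}.$$ *)

(* Defs.v *)
From HB Require Import structures.
From mathcomp Require Import all_boot all_order all_algebra.
From mathcomp Require Import all_classical all_reals all_analysis.
Import Order.TTheory GRing.Theory Num.Theory.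
Import numFieldNormedType.Exports.

Set Implicit Arguments.
Unset Strict Implicit.
Unset Printing Implicit Defensive.

Local Open Scope classical_set_scope.
Local Open Scope ring_scope.

HB.instance Definition _ := isPointed.Build int 0.

HB.instance Definition _ := @isMeasurable.Build default_measure_display
  int discrete_measurable discrete_measurable0
  discrete_measurableC discrete_measurableU.

Section functions.
Context {R : realType}.
Variables a1 a2 b1 b2 : R.

Definition evenz (k : int) : bool := (2 %| k)%Z.

Definition alternating_generator (k n : int) : R :=
  let up := if evenz k then a1 else b1 in
  let down := if evenz k then a2 else b2 in
  if n == k + 1 then up
  else if n == k - 1 then down
  else if n == k then - (up + down)
  else 0.

Definition h (z : R) : R :=
  2^-1 * Num.sqrt ((a1 + a2 - (b1 + b2)) ^+ 2 * z ^+ 2 +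
                   4 * (b1 * z ^+ 2 + b2) * (a1 * z ^+ 2 + a2)).

Definition Lambda (g : R) : R :=
  h (expR g) / expR g - (a1 + a2 + b1 + b2) / 2.

Definition c (k : int) (z : R) : R :=
  if evenz k then (b1 + b2 - (a1 + a2)) * z / 2 + a1 * z ^+ 2 + a2
  else (a1 + a2 - (b1 + b2)) * z / 2 + b1 * z ^+ 2 + b2.

Definition mean_formula (k : int) (t : R) : R :=
  k%:~R + (Lambda^`())%classic 0 * t +
  ((fun z => c k z / h z)^`())%classic 1 *
    ((1 - expR (- (a1 + a2 + b1 + b2) * t)) / 2).

(* Conditional variance of X(t) for an even starting point. *)
Definition var_formula (t : R) : R :=
  (Lambda^`(2))%classic 0 * t
  - expR (- 2 * (a1 + a2 + b1 + b2) * t) *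
      ((a1 + a2) ^+ 2 * (a1 - a2 - b1 + b2) ^+ 2 / (a1 + a2 + b1 + b2) ^+ 4)
  + expR (- (a1 + a2 + b1 + b2) * t) / (a1 + a2 + b1 + b2) ^+ 3 *
    (8 * t * (a1 + a2) * (a1 - a2 - b1 + b2) * (a1 * b1 - a2 * b2)
     + (a1 + a2) * (a1 - a2 - b1 + b2) * (a1 + a2 - b1 - b2)
     - 6 * (a2 - b1) * (a1 - a2 - b1 + b2) * (a1 + a2 - b1 - b2)
     - 2 * (7 * a2 + b1 - 2 * b2) * (b1 + b2) * (a1 + a2 - b1 - b2)
     - 4 * (a2 - b2) ^+ 2 * (a1 + a2 - b1 - b2)
     + 8 * a2 * (b1 + b2) * (a1 + a2)
     - 8 * a2 * (b1 + b2) * (a1 - a2 - b1 + b2)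
     + 8 * b1 * (b1 + b2) ^+ 2
     - 16 * (a2 + b1) ^+ 2 * (b1 + b2) ^+ 2 / (a1 + a2 + b1 + b2))
  + 1 / (a1 + a2 + b1 + b2) ^+ 3 *
    ((- 7 * a1 + 3 * a2 + 10 * b1 - 4 * b2) * (b1 + b2) * (a1 - a2 - b1 + b2)
     + 4 * (a2 + a1) * (a2 + 2 * b2) * (a1 - a2 - b1 + b2)
     + 4 * (a2 - b2) ^+ 2 * (a1 - a2 - b1 + b2)
     + 4 * (a2 - b2) * (a2 + b1) * (b1 + b2)
     - 10 * (a2 + b1) * (b1 + b2) ^+ 2
     + 8 * (a2 + b1) * (a2 - b2) ^+ 2)
  + 20 * (a2 + b1) ^+ 2 * (b1 + b2) ^+ 2 / (a1 + a2 + b1 + b2) ^+ 4.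

End functions.

Section transition_function.
Context {R : realType}.

(* [p k n t] is the probability of going from [k] to [n] in time [t >= 0];
   values at [t < 0] are irrelevant. *)
Definition is_transition_function (p : int -> int -> R -> R) : Prop :=
  [/\ forall k n t, 0 <= t -> 0 <= p k n t,
      forall k t, 0 <= t -> (\esum_(n in [set: int]) (p k n t)%:E = 1)%E,
      forall k n, p k n 0 = (k == n)%:R
    & forall k n s t, 0 <= s -> 0 <= t ->
        ((p k n (s + t))%:E
         = \esum_(m in [set: int]) (p k m s * p m n t)%:E)%E].

Definition has_generator (p : int -> int -> R -> R) (g : int -> int -> R) : Prop :=
  forall k n, (p k n t - p k n 0) / t @[t --> 0^'+] --> g k n.

End transition_function.

Section markov_chain.
Context {d : measure_display} {T : measurableType d} {R : realType}.
Variable P : probability T R.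

Definition cond_prob (A B : set T) : R := fine (P (A `&` B)) / fine (P B).

(* Time-homogeneous Markov property; the history [s] is a finite list of
   pairs (time, state) with times in [0, t], in any order, possibly empty. *)
Definition is_markov_chain (X : R -> {RV P >-> int})
    (p : int -> int -> R -> R) : Prop :=
  forall (s : seq (R * int)) (t u : R) (i j : int),
    0 <= t -> 0 <= u ->
    (forall x, x \in s -> 0 <= x.1 <= t) ->
    let past := [set w | X t w = i /\ forall x, x \in s -> X x.1 w = x.2] in
    (0 < P past)%E ->
    cond_prob [set w | X (t + u) w = j] past = p i j u.

Lemma measurable_RV_eq (Y : {RV P >-> int}) (k : int) :
  measurable [set w | Y w = k].
Proof.
rewrite -[X in measurable X]setTI.
exact: (measurable_funP Y measurableT [set k]).
Qed.

(* The probability P( . | Y = k); by convention of [mnormalize] it is [P]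
   itself when [Y = k] is a null event. *)
Definition cond_law (Y : {RV P >-> int}) (k : int) : probability T R :=
  mnormalize (mrestr P (measurable_RV_eq Y k)) P.

End markov_chain.

(* Main.v *)
(**
The generator acts on functions of the form [(k + u_e(t))^2 + s_e(t)], where the
index [e] is the parity of [k], so [k + mean] and [(k + mean - x)^2 + variance]
can be checked to be exact solutions of the backward equation [M' = G M].

The backward equation for [p] itself follows from Chapman-Kolmogorov and the
three nonzero entries of each row of the generator, since the remaining entries
of the row [p k _ s] have total mass [o(s)].  A minimum principle for this
equation shows that a supersolution [w] which tends to infinity at infinity
dominates every finite sum [\sum_n p k n t * F n] such that [0 <= F <= w(., 0)].
Taking for [w] a small multiple of [(1 + k^2)^2 e^(r t)] plus [M] or [- M] plus a
constant yields [E M(X(t), 0) = M(k, t)].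
*)
Require Import Defs.
From HB Require Import structures.
From mathcomp Require Import all_boot all_order all_algebra.
From mathcomp Require Import all_classical all_reals all_analysis.
From mathcomp Require Import measurable_realfun ring lra zify.
Import Order.TTheory GRing.Theory Num.Theory.
Import numFieldNormedType.Exports.

Set Implicit Arguments.
Unset Strict Implicit.
Unset Printing Implicit Defensive.

Local Open Scope classical_set_scope.
Local Open Scope ring_scope.

(* Not a class, unlike [is_derive], so that unification variables standing for
   derivatives are not filled in by instance resolution. *)
Definition has_derivative (R : realType) (f : R -> R) (x a : R) : Prop :=
  is_derive x 1 f a.

(** * Differentiation rules for explicit formulas *)

Section derivatives.
Variable R : realType.
Implicit Types (f g : R -> R) (x a b : R).

Lemma has_derivative_cst x a : has_derivative (fun=> a) x 0.
Proof. exact: is_derive_cst. Qed.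

Lemma has_derivative_id x : has_derivative (fun t => t) x 1.
Proof. exact: is_derive_id. Qed.

Lemma has_derivativeD f g x a b :
  has_derivative f x a -> has_derivative g x b ->
  has_derivative (fun t => f t + g t) x (a + b).
Proof. exact: is_deriveD. Qed.

Lemma has_derivativeN f x a : has_derivative f x a ->
  has_derivative (fun t => - f t) x (- a).
Proof. exact: is_deriveN. Qed.

Lemma has_derivativeM f g x a b :
  has_derivative f x a -> has_derivative g x b ->
  has_derivative (fun t => f t * g t) x (f x * b + g x * a).
Proof. exact: is_deriveM. Qed.

Lemma has_derivativeX f n x a : has_derivative f x a ->
  has_derivative (fun t => f t ^+ n) x (n%:R * f x ^+ n.-1 * a).
Proof.
move=> fa; have := is_deriveX n fa.
by rewrite (_ : f ^+ n = fun t => f t ^+ n)//; apply/funext => t; rewrite fctE.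
Qed.

Lemma has_derivative_expR f x a : has_derivative f x a ->
  has_derivative (fun t => expR (f t)) x (expR (f x) * a).
Proof. by move=> fa; exact: (@is_derive1_comp _ expR f). Qed.

Lemma has_derivative_sqrt f x a : 0 < f x -> has_derivative f x a ->
  has_derivative (fun t => Num.sqrt (f t)) x ((2 * Num.sqrt (f x))^-1 * a).
Proof.
move=> fx fa; apply: (@is_derive1_comp _ Num.sqrt f) => //.
exact: is_derive1_sqrt.
Qed.

Lemma has_derivativeV f x a : f x != 0 -> has_derivative f x a ->
  has_derivative (fun t => (f t)^-1) x (- (f x) ^- 2 * a).
Proof. exact: is_deriveV. Qed.

Lemma has_derivative_eq f x a b :
  has_derivative f x a -> a = b -> has_derivative f x b.
Proof. by move=> fa <-. Qed.

Lemma derive1_val f x a b : has_derivative f x a -> a = b ->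
  (f^`())%classic x = b.
Proof. by move=> fa <-; rewrite derive1E; exact: (@derive_val _ _ _ _ _ _ _ fa). Qed.

End derivatives.

Ltac derivative_rules :=
  repeat first
  [ exact: has_derivative_cst | exact: has_derivative_id
  | apply: has_derivativeD | apply: has_derivativeN | apply: has_derivativeM
  | apply: has_derivativeX | apply: has_derivative_expR
  | apply: has_derivative_sqrt | apply: has_derivativeV ].

(** * Derivatives of [Lambda] and [c k / h] *)

Section Lambda_derivatives.
Variables (R : realType) (a1 a2 b1 b2 : R).
Hypotheses (ha1 : 0 < a1) (ha2 : 0 < a2) (hb1 : 0 < b1) (hb2 : 0 < b2).

Let S := a1 + a2 + b1 + b2.
Let S_gt0 : 0 < S. Proof. by rewrite /S !addr_gt0. Qed.

(** This is the radicand of [h] at [z = e^g] divided by [z^2]. No quotient by [e^g] is left to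
    differentiate. *)
Let Q (g : R) := (a1 + a2 - (b1 + b2)) ^+ 2 + 4 * (a1 * b2 + a2 * b1)
  + 4 * (a1 * b1) * expR (2 * g) + 4 * (a2 * b2) * expR (- 2 * g).

Let Q_gt0 g : 0 < Q g.
Proof.
rewrite /Q; have := expR_gt0 (2 * g); have := expR_gt0 (- 2 * g) => E1 E2.
by rewrite ltr_wpDl ?mulr_gt0 ?addr_ge0 ?sqr_ge0 ?mulr_ge0 ?addr_ge0 ?mulr_ge0 // ltW.
Qed.

(** With [A = a1 + a2] and [B = b1 + b2], the value [Q 0] is the perfect square
    [(A - B)^2 + 4 A B = (A + B)^2]. *)
Let sqrtQ0 : Num.sqrt (Q 0) = S.
Proof.
rewrite /Q !mulr0 expR0 (_ : _ + _ = S ^+ 2); last by rewrite /S; ring.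
by rewrite sqrtr_sqr ger0_norm// ltW.
Qed.

Lemma LambdaE : Lambda a1 a2 b1 b2 = fun g => 2^-1 * Num.sqrt (Q g) - S / 2.
Proof.
apply/funext => g; rewrite /Lambda /h; congr (_ - _).
have e0 := expR_gt0 g.
rewrite -[LHS]mulrA; congr (_ * _).
(* The denominator [e^g] is positive, so it enters the root as its square. *)
rewrite -[X in X^-1](ger0_norm (ltW e0)) -sqrtr_sqr -sqrtrV ?sqr_ge0//.
rewrite -sqrtrM; last first.
  by repeat first [exact: sqr_ge0 | exact: ltW | exact: ler0n
    | apply: addr_ge0 | apply: mulr_ge0].
congr Num.sqrt.
rewrite /Q (_ : 2 * g = g + g); last by ring.
rewrite (_ : - 2 * g = - (g + g)); last by ring.
rewrite expRN expRD.
by field; rewrite gt_eqF.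
Qed.

Lemma derive1_Lambda : (Lambda a1 a2 b1 b2)^`()%classic =
  fun g => 2 * (a1 * b1 * expR (2 * g) - a2 * b2 * expR (- 2 * g)) / Num.sqrt (Q g).
Proof.
apply/funext => g; rewrite LambdaE.
eapply derive1_val; first by derivative_rules; exact: Q_gt0.
have : Num.sqrt (Q g) != 0 by rewrite gt_eqF// sqrtr_gt0.
rewrite -/(Q g) => ?; by field.
Qed.

Lemma derive1_Lambda0 :
  (Lambda a1 a2 b1 b2)^`()%classic 0 = 2 * (a1 * b1 - a2 * b2) / S.
Proof. by rewrite derive1_Lambda sqrtQ0 !mulr0 expR0 !mulr1. Qed.

Lemma derive2_Lambda0 : (Lambda a1 a2 b1 b2)^`(2)%classic 0 =
  4 * (a1 * b1 + a2 * b2) / S - 8 * (a1 * b1 - a2 * b2) ^+ 2 / S ^+ 3.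
Proof.
rewrite derive1nS derive1n1 derive1_Lambda; eapply derive1_val.
  derivative_rules; first by rewrite gt_eqF// sqrtr_gt0.
  exact: Q_gt0.
rewrite -/(Q 0) !sqrtQ0 !mulr0 expR0.
by field; rewrite gt_eqF.
Qed.

Lemma derive1_c_div_h (k : int) :
  ((fun z => c a1 a2 b1 b2 k z / h a1 a2 b1 b2 z)^`())%classic 1 =
  if evenz k
  then 2 * (a1 + a2) * (a1 - a2 - b1 + b2) / S ^+ 2
  else 2 * (b1 + b2) * (b1 - b2 - a1 + a2) / S ^+ 2.
Proof.
have E : (a1 + a2 - (b1 + b2)) ^+ 2 * 1 ^+ 2 +
   4 * (b1 * 1 ^+ 2 + b2) * (a1 * 1 ^+ 2 + a2) = S ^+ 2 by rewrite /S; ring.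
have sE : Num.sqrt (S ^+ 2) = S by rewrite sqrtr_sqr ger0_norm// ltW.
rewrite /c /h; case: ifPn => _.
all: eapply derive1_val; [derivative_rules|].
all: rewrite /= !E ?exprn_gt0 // !sE ?mulf_neq0 ?gt_eqF //.
all: rewrite /S; field.
all: by rewrite -/S gt_eqF.
Qed.

End Lambda_derivatives.

(** * Explicit solutions of the backward equation *)

Section moments.
Variable R : realType.

(** Expected displacement from an even starting point; exchanging the [a]'s and the [b]'s serves odd
    starting points. *)
Definition mean_shift (a1 a2 b1 b2 t : R) : R :=
  2 * (a1 * b1 - a2 * b2) / (a1 + a2 + b1 + b2) * t
  + (a1 + a2) * (a1 - a2 - b1 + b2) / (a1 + a2 + b1 + b2) ^+ 2 *
    (1 - expR (- (a1 + a2 + b1 + b2) * t)).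

Lemma mean_formulaE (a1 a2 b1 b2 : R) (k : int) (t : R) :
  0 < a1 -> 0 < a2 -> 0 < b1 -> 0 < b2 ->
  mean_formula a1 a2 b1 b2 k t =
  k%:~R + if evenz k then mean_shift a1 a2 b1 b2 t else mean_shift b1 b2 a1 a2 t.
Proof.
move=> ha1 ha2 hb1 hb2; rewrite /mean_formula derive1_Lambda0// derive1_c_div_h//.
rewrite -addrA; congr (_ + _).
have S0 : a1 + a2 + b1 + b2 != 0 by rewrite gt_eqF// !addr_gt0.
case: ifPn => _; rewrite /mean_shift.
  by field.
rewrite (_ : b1 + b2 + a1 + a2 = a1 + a2 + b1 + b2); last by ring.
by field.
Qed.

(** A jump changes the parity, so the backward equation for [k + mean] couples the two shifts; [k]
    cancels and a system of two linear equations in [t] remains. *)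
Lemma derivative_mean_shift (a1 a2 b1 b2 t : R) :
  a1 + a2 + b1 + b2 != 0 ->
  has_derivative (mean_shift a1 a2 b1 b2) t
   (a1 - a2 + (a1 + a2) * (mean_shift b1 b2 a1 a2 t - mean_shift a1 a2 b1 b2 t)).
Proof.
move=> S0; rewrite /mean_shift.
rewrite (_ : b1 + b2 + a1 + a2 = a1 + a2 + b1 + b2); last by ring.
eapply has_derivative_eq; first by derivative_rules.
move: (expR _) => E.
by field.
Qed.

(** This is what remains of the backward equation for [(k + m - x)^2 + v] once the terms linear in
    [k + m - x] are cancelled by the equation for [m]. *)
Lemma derivative_var (a1 a2 b1 b2 t : R) :
  0 < a1 -> 0 < a2 -> 0 < b1 -> 0 < b2 ->
  let m := mean_shift a1 a2 b1 b2 t in let m' := mean_shift b1 b2 a1 a2 t in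
  has_derivative (var_formula a1 a2 b1 b2) t
   (a1 + a2 + (a1 + a2) * ((m' - m) ^+ 2 +
      var_formula b1 b2 a1 a2 t - var_formula a1 a2 b1 b2 t)
      + 2 * (a1 - a2) * (m' - m)).
Proof.
move=> ha1 ha2 hb1 hb2 m m'; rewrite {}/m {}/m' /var_formula !derive2_Lambda0//.
have S0 : a1 + a2 + b1 + b2 != 0 by rewrite gt_eqF// !addr_gt0.
rewrite /mean_shift.
rewrite (_ : b1 + b2 + a1 + a2 = a1 + a2 + b1 + b2); last by ring.
set E := expR (- (a1 + a2 + b1 + b2) * t).
(* Expressing both exponentials through [E] reduces the claim to a rational identity in [E], [t] and
   the rates. *)
have EE : expR (- 2 * (a1 + a2 + b1 + b2) * t) = E ^+ 2.
  by rewrite expr2 -expRD; congr expR; ring.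
eapply has_derivative_eq; first by derivative_rules.
rewrite !EE -!/E.
by move: E {EE} => E; field.
Qed.

End moments.

Lemma mean_shift0 (R : realType) (a1 a2 b1 b2 : R) : mean_shift a1 a2 b1 b2 0 = 0.
Proof. by rewrite /mean_shift !mulr0 expR0 subrr mulr0 addr0. Qed.

Lemma var_formula0 (R : realType) (a1 a2 b1 b2 : R) :
  a1 + a2 + b1 + b2 != 0 -> var_formula a1 a2 b1 b2 0 = 0.
Proof. by move=> S0; rewrite /var_formula !mulr0 expR0; field. Qed.

Lemma evenzD1 (k : int) : evenz (k + 1) = ~~ evenz k.
Proof. by rewrite /evenz; lia. Qed.

Lemma evenzB1 (k : int) : evenz (k - 1) = ~~ evenz k.
Proof. by rewrite /evenz; lia. Qed.

Section generator.
Variables (R : realType) (a1 a2 b1 b2 : R).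

Definition gen (f : int -> R) (k : int) : R :=
  (if evenz k then a1 else b1) * (f (k + 1) - f k) +
  (if evenz k then a2 else b2) * (f (k - 1) - f k).

Definition mean_solution (k : int) (t : R) : R :=
  k%:~R + if evenz k then mean_shift a1 a2 b1 b2 t else mean_shift b1 b2 a1 a2 t.

(** Solution with initial value [(k - x)^2]. The centre [x] stays free: taking it to be the mean at
    the final time turns the value there into the variance. *)
Definition square_solution (x : R) (k : int) (t : R) : R :=
  (mean_solution k t - x) ^+ 2 +
  if evenz k then var_formula a1 a2 b1 b2 t else var_formula b1 b2 a1 a2 t.

Hypotheses (ha1 : 0 < a1) (ha2 : 0 < a2) (hb1 : 0 < b1) (hb2 : 0 < b2).

Let S0 : a1 + a2 + b1 + b2 != 0. Proof. by rewrite gt_eqF// !addr_gt0. Qed.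
Let S0' : b1 + b2 + a1 + a2 != 0. Proof. by rewrite gt_eqF// !addr_gt0. Qed.

Lemma mean_solution0 k : mean_solution k 0 = k%:~R.
Proof. by rewrite /mean_solution !mean_shift0 if_same addr0. Qed.

Lemma square_solution0 x k : square_solution x k 0 = (k%:~R - x) ^+ 2.
Proof.
by rewrite /square_solution mean_solution0 !var_formula0// if_same addr0.
Qed.

Lemma derivative_mean_solution k t :
  has_derivative (mean_solution k) t (gen (mean_solution ^~ t) k).
Proof.
rewrite /gen /mean_solution evenzD1 evenzB1 !intrD mulrN1z mulr1z.
case: (evenz k) => /=.
all: eapply has_derivative_eq;
  [apply: has_derivativeD; [exact: has_derivative_cst|exact: derivative_mean_shift]|].
all: ring.
Qed.

Lemma derivative_square_solution x k t :
  has_derivative (square_solution x k) t (gen (square_solution x ^~ t) k).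
Proof.
have dm : has_derivative (fun t => (mean_solution k t - x) ^+ 2) t
    (2 * (mean_solution k t - x) * gen (mean_solution ^~ t) k).
  eapply has_derivative_eq.
    apply: has_derivativeX; apply: has_derivativeD; last exact: has_derivative_cst.
    exact: derivative_mean_solution.
  by rewrite /=; ring.
rewrite /square_solution.
eapply has_derivative_eq.
  apply: has_derivativeD; first exact: dm.
  instantiate (1 := if evenz k then _ else _); case: (evenz k); exact: derivative_var.
rewrite /gen /mean_solution evenzD1 evenzB1 !intrD mulrN1z mulr1z.
by case: (evenz k) => /=; ring.
Qed.

End generator.

(** * Minimum principle *)

Section comparison.
Variable R : realType.

Lemma near_seq (I : eqType) (T : Type) (F : set_system T) (FF : Filter F)
    (K : seq I) (P : I -> T -> Prop) :
  (forall k, k \in K -> \forall x \near F, P k x) ->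
  \forall x \near F, forall k, k \in K -> P k x.
Proof.
elim: K => [_|i K IH FP]; first exact: nearW.
have FK : \forall x \near F, forall k, k \in K -> P k x.
  by apply: IH => k kK; apply: FP; rewrite inE kK orbT.
have Fi : \forall x \near F, P i x by apply: FP; rewrite mem_head.
apply: filterS2 Fi FK => x Pix PKx k.
by rewrite inE => /orP[/eqP ->|/PKx].
Qed.

Lemma near0_rightP (P : R -> Prop) : (\forall s \near 0^'+, P s) <->
  exists2 e : R, 0 < e & forall s, 0 < s < e -> P s.
Proof.
rewrite near_withinE; split.
  move=> /nbhs_ballP[e /= e0 H]; exists e => // s /andP[s0 se].
  by apply: H => //; rewrite /ball/= sub0r normrN gtr0_norm.
move=> [e e0 H]; apply/nbhs_ballP; exists e => //= s.
rewrite /ball/= sub0r normrN => se s0.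
by apply: H; rewrite s0 -(gtr0_norm s0).
Qed.

(** Let [c] be the supremum of the [u] such that [Q] holds on [[0, u]]. The left condition gives [Q]
    at [c], and if [c < T] the right condition extends [Q] beyond [c]. *)
Lemma real_induction (T : R) (Q : R -> Prop) :
  Q 0 ->
  (forall t : R, 0 <= t < T -> Q t -> \forall s \near 0^'+, Q (t + s)) ->
  (forall t : R, 0 < t <= T -> (forall s : R, 0 <= s < t -> Q s) -> Q t) ->
  forall t : R, 0 <= t <= T -> Q t.
Proof.
move=> Q0 Qright Qleft t /andP[t0 tT].
have T0 : 0 <= T by exact: le_trans tT.
pose A := [set u | 0 <= u <= T /\ forall s : R, 0 <= s <= u -> Q s].
have A0 : A 0.
  by split; [rewrite lexx T0|move=> s; rewrite -eq_le => /eqP <-].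
have hA : has_sup A.
  by split; [exists 0|exists T => u -[/andP[]]].
have c0 : 0 <= sup A by apply: sup_upper_bound.
have cT : sup A <= T by apply: ge_sup; [exists 0|move=> u [/andP[]]].
have Qlt s : 0 <= s < sup A -> Q s.
  move=> /andP[s0 /(sup_gt hA.1)[u [_ Qu] su]].
  by apply: Qu; rewrite s0 ltW.
have Qc : Q (sup A).
  move: c0; rewrite le_eqVlt => /predU1P[<-//|c0].
  by apply: Qleft => //; rewrite c0.
have [Tc|cltT] := leP T (sup A).
  have : t <= sup A by exact: le_trans Tc.
  rewrite le_eqVlt => /predU1P[->//|tc].
  by apply: Qlt; rewrite t0.
have cT' : 0 <= sup A < T by rewrite c0.
have /near0_rightP[e e0 Qe] := Qright _ cT' Qc.
(* The minimum keeps [u] both within the right neighbourhood of the supremum and below [T]. *)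
pose u := sup A + Num.min (e / 2) (T - sup A).
have cu : sup A < u by rewrite ltrDl lt_min divr_gt0//= subr_gt0.
suff : A u by move=> /(sup_upper_bound hA); rewrite leNgt cu.
split.
  rewrite (le_trans c0 (ltW cu))/= /u -lerBrDl ge_min lexx orbT//.
move=> s /andP[s0 su]; have [sc|cs|->//] := ltgtP s (sup A).
  by apply: Qlt; rewrite s0.
rewrite -(subrKC (sup A) s); apply: Qe; rewrite subr_gt0 cs/= ltrBlDl.
rewrite (le_lt_trans su)// ltrD2l gt_min ltr_pdivrMr// mulr_natr mulr2n.
by rewrite ltrDl e0.
Qed.

(** A function positive at [t] cannot drop below zero at once when its right derivative is finite;
    one that vanishes at [t] is pushed up by a positive right derivative. *)
Lemma right_quotient_ge0 (f : R -> R) (t l : R) :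
  (f (t + s) - f t) / s @[s --> 0^'+] --> l -> 0 <= f t -> (f t = 0 -> 0 < l) ->
  \forall s \near 0^'+, 0 <= f (t + s).
Proof.
move=> fl; rewrite le_eqVlt => /predU1P[/esym f0|f0] hl.
  have l0 := hl f0.
  near=> s.
  have s0 : 0 < s by near: s; exact: nbhs_right_gt.
  suff : 0 < (f (t + s) - f t) / s.
    by rewrite f0 subr0 pmulr_lgt0 ?invr_gt0// => /ltW.
  near: s; exact: cvgr_gt fl _ l0.
near=> s.
have s0 : 0 < s by near: s; exact: nbhs_right_gt.
have : l - 1 < (f (t + s) - f t) / s.
  by near: s; apply: cvgr_gt fl _ _; rewrite ltrBlDr ltrDl.
have : s * (`|l - 1| + 1) < f t.
  rewrite -ltr_pdivlMr ?ltr_wpDl//.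
  by near: s; apply: nbhs_right_lt; rewrite divr_gt0// ltr_wpDl.
rewrite ltr_pdivlMr// => h1 h2.
have : - s * `|l - 1| <= s * (l - 1).
  by rewrite mulNr -mulrN ler_pM2l// lerNl -normrN ler_norm.
nra.
Unshelve. all: by end_near. Qed.

Lemma has_derivative_right (f : R -> R) (t l : R) : has_derivative f t l ->
  (f (t + s) - f t) / s @[s --> 0^'+] --> l.
Proof.
move=> [df <-]; move: df; rewrite /derivable /derive => df.
have H := cvg_dnbhs_at_right df.
apply: cvg_trans H; apply: near_eq_cvg; near=> s.
by rewrite /= [s%:A]mulr1 (addrC t) [LHS]mulrC.
Unshelve. all: by end_near. Qed.

Lemma has_derivative_left_continuous (f : R -> R) (t l : R) :
  has_derivative f t l -> f s @[s --> t^'-] --> f t.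
Proof.
move=> [df _]; apply: cvg_at_left_filter.
exact/differentiable_continuous/derivable1_diffP.
Qed.

(** Continuous induction in time, with one-sided regularity: left limits and right derivatives are
    what Chapman-Kolmogorov provides for [p]. Finiteness of [K] gives a common right neighbourhood
    for all its indices. *)
Lemma supersolution_ge0 (a1 a2 b1 b2 T : R) (K : seq int) (v D : int -> R -> R) :
  0 <= a1 -> 0 <= a2 -> 0 <= b1 -> 0 <= b2 ->
  (forall k t, k \notin K -> 0 <= t <= T -> 0 <= v k t) ->
  (forall k, 0 <= v k 0) ->
  (forall k (t : R), 0 < t -> v k s @[s --> t^'-] --> v k t) ->
  (forall k (t : R), 0 <= t ->
    (v k (t + s) - v k t) / s @[s --> 0^'+] --> D k t) ->
  (forall k (t : R), 0 <= t -> gen a1 a2 b1 b2 (v ^~ t) k <= D k t) ->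
  forall k t, 0 <= t <= T -> 0 <= v k t.
Proof.
move=> ha1 ha2 hb1 hb2 hout h0 hleft hder hD k t /[dup] tT /andP[t0 _].
(* The term [e (1 + t)] makes the differential inequality strict: at a first zero
   the right derivative is positive. *)
suff H e : 0 < e -> 0 <= v k t + e * (1 + t).
  apply/ler_addgt0Pr => e e0.
  have := H (e / (1 + t)); rewrite divfK ?gt_eqF ?ltr_wpDr// => -> //.
  by rewrite divr_gt0// ltr_wpDr.
move=> e0; move: t tT t0.
suff : forall t : R, 0 <= t <= T -> forall k, 0 <= v k t + e * (1 + t).
  by move=> H t tT _; exact: H.
have w0 : forall t : R, 0 <= t -> 0 < e * (1 + t).
  by move=> t t0; rewrite mulr_gt0// ltr_wpDr.
apply: real_induction.
- by move=> j; rewrite addr_ge0// ltW// w0.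
- move=> t /andP[t0 tT] Q.
  have nK : \forall s \near 0^'+, forall j, j \in K ->
      0 <= v j (t + s) + e * (1 + (t + s)).
    apply: near_seq => j _.
    apply: (@right_quotient_ge0 (fun x => v j x + e * (1 + x)) _ (D j t + e)) => //.
      have : ((v j (t + s) - v j t) / s + e) @[s --> 0^'+] --> D j t + e.
        by apply: cvgD; [exact: hder|exact: cvg_cst].
      apply: cvg_trans; apply: near_eq_cvg; near=> s.
      have s0 : 0 < s by near: s; exact: nbhs_right_gt.
      by field; rewrite gt_eqF.
    (* At a zero of the perturbed function, [v j t = - e (1 + t)] is at most the values at both
       neighbours, so the generator is nonnegative there and [D j t + e > 0]. *)
    move=> vj0; rewrite ltr_wpDl// (le_trans _ (hD _ _ t0))//.
    rewrite /gen; have Q1 := Q (j + 1); have Q2 := Q (j - 1).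
    by case: ifPn => _; rewrite addr_ge0// mulr_ge0//; lra.
  near=> s => j.
  have s0 : 0 < s by near: s; exact: nbhs_right_gt.
  have ts : 0 <= t + s by rewrite addr_ge0// ltW.
  have [jK|jK] := boolP (j \in K).
    by move: j jK; near: s.
  rewrite addr_ge0 ?(ltW (w0 _ _))// hout// ts/=.
  rewrite -lerBrDl; near: s; apply: nbhs_right_le.
  by rewrite subr_gt0.
- move=> t /andP[t0 tT] Q j.
  have : v j s + e * (1 + s) @[s --> t^'-] --> v j t + e * (1 + t).
    apply: cvgD; first exact: hleft.
    apply: cvg_at_left_filter; apply: cvgM; first exact: cvg_cst.
    by apply: cvgD; [exact: cvg_cst|exact: cvg_id].
  move=> H; rewrite leNgt; apply/negP => neg.
  (* A negative value at [t] would persist just before [t] by left continuity. *)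
  have : \forall s \near t^'-, False.
    near=> s.
    have : v j s + e * (1 + s) < 0 by near: s; exact: cvgr_lt H _ neg.
    rewrite ltNge => /negP; apply; apply: Q; apply/andP; split.
      by near: s; exact: nbhs_left_ge.
    by near: s; exact: nbhs_left_lt.
  by move=> /filter_ex[].
Unshelve. all: by end_near. Qed.

End comparison.

(** * Regularity of transition functions *)

Section transition_function.
Variable R : realType.

Lemma sum_le_esum (I : choiceType) (f : I -> R) (s : seq I) : uniq s ->
  (forall i, 0 <= f i) ->
  ((\sum_(i <- s) f i)%:E <= \esum_(i in [set: I]) (f i)%:E)%E.
Proof.
move=> us f0; apply: esum_ge; exists [set` s]; first by split.
by rewrite -fsbig_seq// sumEFin.
Qed.

(** The weights outside [s] have total mass [1 - \sum_(i <- s) x i] and multiply values in [[0, 1]].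
    The upper bound is the lower bound for the complementary values [1 - y i]. *)
Lemma esum_average (I : choiceType) (x y : I -> R) (z : R) (s : seq I) :
  uniq s -> (forall i, 0 <= x i) ->
  (\esum_(i in [set: I]) (x i)%:E = 1)%E ->
  (forall i, 0 <= y i <= 1) ->
  (z%:E = \esum_(i in [set: I]) (x i * y i)%:E)%E ->
  \sum_(i <- s) x i * y i <= z <= \sum_(i <- s) x i * y i + (1 - \sum_(i <- s) x i).
Proof.
move=> us x0 x1 y01 zE; apply/andP; split.
  rewrite -lee_fin zE; apply: sum_le_esum => // i.
  by rewrite mulr_ge0//; case/andP: (y01 i).
have xy0 i : 0 <= x i * (1 - y i).
  by rewrite mulr_ge0// subr_ge0; case/andP: (y01 i).
have : (1 = z%:E + \esum_(i in [set: I]) (x i * (1 - y i))%:E :> \bar R)%E.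
  rewrite zE -esumD; last 2 first.
  - by move=> i _; rewrite lee_fin mulr_ge0//; case/andP: (y01 i).
  - by move=> i _; rewrite lee_fin.
  by rewrite -x1; apply: eq_esum => i _; rewrite -EFinD; congr EFin; ring.
have := sum_le_esum us xy0.
move=> h E; move: h; rewrite -(leeD2lE (x := z%:E))// -E -EFinD lee_fin.
under [X in z + X]eq_bigr do rewrite mulrBr mulr1.
by rewrite sumrB; lra.
Qed.

Section alternating.
Variables (a1 a2 b1 b2 : R) (p : int -> int -> R -> R).
Hypotheses (hp : is_transition_function p)
  (hg : has_generator p (alternating_generator a1 a2 b1 b2)).

Let p_ge0 k n (t : R) : 0 <= t -> 0 <= p k n t.
Proof. by case: hp => + _ _ _; exact. Qed.

Let p_sum k (t : R) : 0 <= t -> (\esum_(n in [set: int]) (p k n t)%:E = 1)%E.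
Proof. by case: hp => _ + _ _; exact. Qed.

Let p0 k n : p k n 0 = (k == n)%:R.
Proof. by case: hp => _ _ + _; exact. Qed.

Let p_le1 k n (t : R) : 0 <= t -> p k n t <= 1.
Proof.
move=> t0; have := @sum_le_esum _ (p k ^~ t) [:: n] isT (fun n => p_ge0 k n t0).
by rewrite p_sum// big_seq1 lee_fin.
Qed.

Lemma transition_average (s : seq int) k n (t u : R) :
  uniq s -> 0 <= t -> 0 <= u ->
  \sum_(m <- s) p k m u * p m n t <= p k n (u + t)
    <= \sum_(m <- s) p k m u * p m n t + (1 - \sum_(m <- s) p k m u).
Proof.
move=> us t0 u0; apply: esum_average => //.
- by move=> m; exact: p_ge0.
- exact: p_sum.
- by move=> m; rewrite p_ge0// p_le1.
- by case: hp => _ _ _; exact.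
Qed.

Lemma sum_transition_le1 (s : seq int) k (t : R) : uniq s -> 0 <= t ->
  \sum_(n <- s) p k n t <= 1.
Proof.
move=> us t0; have := @sum_le_esum _ (p k ^~ t) s us (fun n => p_ge0 k n t0).
by rewrite p_sum// lee_fin.
Qed.

Lemma generator_same k : alternating_generator a1 a2 b1 b2 k k =
  - ((if evenz k then a1 else b1) + (if evenz k then a2 else b2)).
Proof.
rewrite /alternating_generator eqxx.
rewrite (_ : k == k + 1 = false); last by lia.
by rewrite (_ : k == k - 1 = false)//; lia.
Qed.

Lemma generator_up k : alternating_generator a1 a2 b1 b2 k (k + 1) =
  if evenz k then a1 else b1.
Proof. by rewrite /alternating_generator eqxx. Qed.

Lemma generator_down k : alternating_generator a1 a2 b1 b2 k (k - 1) =
  if evenz k then a2 else b2.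
Proof.
rewrite /alternating_generator eqxx.
by rewrite (_ : k - 1 == k + 1 = false)//; lia.
Qed.

(** Chapman-Kolmogorov with the short step [s] first: up to mass [o(s)], that step ends at [k],
    [k + 1] or [k - 1], because the three generator entries sum to zero. *)
Lemma transition_derivative k n (t : R) : 0 <= t ->
  (p k n (t + s) - p k n t) / s @[s --> 0^'+] -->
    gen a1 a2 b1 b2 (fun m => p m n t) k.
Proof.
move=> t0.
set u := if evenz k then a1 else b1; set d := if evenz k then a2 else b2.
have h0 : (p k k s - 1) / s @[s --> 0^'+] --> - (u + d).
  by have := @hg k k; rewrite generator_same p0 eqxx.
have h1 : p k (k + 1) s / s @[s --> 0^'+] --> u.
  have := @hg k (k + 1); rewrite generator_up p0.
  rewrite (_ : k == k + 1 = false); last by lia.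
  by under eq_cvg do rewrite subr0.
have h2 : p k (k - 1) s / s @[s --> 0^'+] --> d.
  have := @hg k (k - 1); rewrite generator_down p0.
  rewrite (_ : k == k - 1 = false); last by lia.
  by under eq_cvg do rewrite subr0.
have us : uniq [:: k; k + 1; k - 1] by rewrite /= !inE; lia.
pose g s := (p k k s - 1) / s * p k n t +
  p k (k + 1) s / s * p (k + 1) n t + p k (k - 1) s / s * p (k - 1) n t.
(* [- r s * s] is the mass sent outside the three states; it bounds the error of [g]. *)
pose r s := (p k k s - 1) / s + p k (k + 1) s / s + p k (k - 1) s / s.
have gl : g s @[s --> 0^'+] --> gen a1 a2 b1 b2 (fun m => p m n t) k.
  rewrite (_ : gen _ _ _ _ _ _ =
    - (u + d) * p k n t + u * p (k + 1) n t + d * p (k - 1) n t); last first.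
    by rewrite /gen -/u -/d; ring.
  by apply: cvgD; [apply: cvgD|]; apply: cvgM => //; exact: cvg_cst.
have rl : r s @[s --> 0^'+] --> 0.
  rewrite [X in _ --> X](_ : _ = - (u + d) + u + d); last by ring.
  by apply: cvgD => //; apply: cvgD.
have near_bounds : \forall s \near 0^'+,
    g s <= (p k n (t + s) - p k n t) / s <= g s - r s.
  near=> s.
  have s0 : 0 < s by near: s; exact: nbhs_right_gt.
  have := transition_average k n us t0 (ltW s0).
  rewrite !big_cons !big_nil !addr0 (addrC s) => H.
  rewrite ler_pdivlMr// ler_pdivrMr//.
  have -> : g s * s = (p k k s - 1) * p k n t + p k (k + 1) s * p (k + 1) n t +
    p k (k - 1) s * p (k - 1) n t by rewrite /g; field; rewrite gt_eqF.
  have -> : (g s - r s) * s = (p k k s - 1) * p k n t +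
    p k (k + 1) s * p (k + 1) n t + p k (k - 1) s * p (k - 1) n t -
    (p k k s - 1 + p k (k + 1) s + p k (k - 1) s).
    by rewrite /g /r; field; rewrite gt_eqF.
  by move: H; lra.
apply: (squeeze_cvgr near_bounds gl).
by rewrite -[X in _ --> X]subr0; apply: cvgB.
Unshelve. all: by end_near. Qed.

(** Staying at [k] during the first [t - s] units of time gives
    [|p k n t - p k n s| <= 1 - p k k (t - s)], and [p k k] tends to 1 at 0 because its right
    derivative there is finite. *)
Lemma transition_left_continuous k n (t : R) : 0 < t ->
  p k n s @[s --> t^'-] --> p k n t.
Proof.
move=> t0.
have h0 : p k k s @[s --> 0^'+] --> (1 : R).
  have : (p k k s - p k k 0) / s * s + p k k 0 @[s --> 0^'+] -->
      alternating_generator a1 a2 b1 b2 k k * 0 + p k k 0.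
    apply: cvgD; last exact: cvg_cst.
    by apply: cvgM; [exact: hg|apply: cvg_at_right_filter; exact: cvg_id].
  rewrite mulr0 add0r p0 eqxx; apply: cvg_trans; apply: near_eq_cvg; near=> s.
  have s0 : 0 < s by near: s; exact: nbhs_right_gt.
  by rewrite divfK ?subrK// gt_eqF.
apply/cvgrPdist_lt => e e0.
have : \forall s \near 0^'+, 1 - e < p k k s.
  by apply: cvgr_gt h0 _ _; rewrite ltrBlDr ltrDl.
move=> /near0_rightP[d d0 hd].
near=> s.
have st : s < t by near: s; exact: nbhs_left_lt.
have s0 : 0 <= s by near: s; exact: nbhs_left_ge.
have std : t - d < s by near: s; apply: nbhs_left_gt; rewrite ltrBlDr ltrDl.
have ts0 : 0 < t - s by rewrite subr_gt0.
have := @transition_average [:: k] k n s (t - s) isT s0 (ltW ts0).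
rewrite !big_seq1 subrK.
have := hd (t - s); rewrite ts0/= => /(_ _) H.
have {}H : 1 - e < p k k (t - s) by apply: H; lra.
have := p_ge0 k k (ltW ts0); have := p_le1 k k (ltW ts0).
have := p_ge0 k n s0; have := p_le1 k n s0.
rewrite ltr_norml; nra.
Unshelve. all: by end_near. Qed.

End alternating.
End transition_function.

(** * Integrals of integer-valued functions and conditional laws *)

(** Enumeration of the integers, used to turn a partition by values in [int] into a sequence of
    sets. *)
Definition int_of_nat (i : nat) : int := if odd i then Negz i./2 else Posz i./2.

Lemma int_of_nat_inj : injective int_of_nat.
Proof. by move=> i j; rewrite /int_of_nat; case: ifP; case: ifP; lia. Qed.

Lemma int_of_nat_surj (n : int) : exists i, int_of_nat i = n.
Proof.
case: n => n; [exists n.*2|exists n.*2.+1]; rewrite /int_of_nat/= odd_double/=.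
  by rewrite doubleK.
by rewrite uphalf_double.
Qed.

Section law.
Context d (T : measurableType d) (R : realType).

(** The integral splits over the level sets of [Y] into a series of nonnegative terms, whose partial
    sums are among the finite sums bounded by [c]. *)
Lemma integral_discrete_le (mu : {measure set T -> \bar R}) (Y : T -> int)
    (q F : int -> R) (c : R) :
  measurable_fun [set: T] Y ->
  (forall n, mu [set w | Y w = n] = (q n)%:E) ->
  (forall n, 0 <= F n) ->
  (forall s : seq int, uniq s -> \sum_(n <- s) q n * F n <= c) ->
  (\int[mu]_w (F (Y w))%:E <= c%:E)%E.
Proof.
move=> mY qE F0 qF.
pose A i := [set w | Y w = int_of_nat i].
have mA i : measurable (A i).
  by rewrite /A -[X in measurable X]setTI; exact: (mY measurableT [set int_of_nat i]).
have mF : measurable_fun [set: T] (EFin \o (F \o Y)).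
  by apply/measurable_EFinP; apply: (measurableT_comp (f := F)) => // _ B _.
have AT : \bigcup_i A i = [set: T].
  by rewrite -subTset => w _; have [i ?] := int_of_nat_surj (Y w); exists i.
rewrite -AT ge0_integral_bigcup//.
- apply: lime_le.
    apply: is_cvg_nneseries => i _ _.
    by apply: integral_ge0 => w _; rewrite lee_fin.
  apply: nearW => N.
  have := qF (map int_of_nat (iota 0 N)).
  rewrite map_inj_uniq ?iota_uniq//; last exact: int_of_nat_inj.
  move=> /(_ isT); rewrite -lee_fin big_map -sumEFin; apply: le_trans.
  rewrite /index_iota subn0; apply: lee_sum => i _.
  rewrite (eq_integral (cst (F (int_of_nat i))%:E)).
    by rewrite integral_cst// /A qE -EFinM mulrC.
  by move=> w; rewrite inE /A/= => ->.
- by rewrite AT.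
- by move=> w _; rewrite lee_fin.
- move=> i j _ _ [w [/= wi wj]]; apply: int_of_nat_inj.
  by rewrite -wi -wj.
Qed.

Lemma cond_law_transition (P : probability T R) (X : R -> {RV P >-> int})
    (p : int -> int -> R -> R) (k n : int) (t : R) :
  is_markov_chain X p -> 0 <= t -> (0 < P [set w | X 0%R w = k])%E ->
  cond_law (X 0) k [set w | X t w = n] = (p k n t)%:E.
Proof.
move=> hX t0 Pk.
(* The Markov property with present time 0 and empty history. *)
have := hX [::] 0 t k n (lexx _) t0 (fun x xn => match notF xn with end).
rewrite (_ : [set w | _ /\ _] = [set w | X 0 w = k]); last first.
  by apply/seteqP; split => w /= => [[]|] //.
move=> /(_ Pk); rewrite add0r => <-.
have Pfin : P [set w | X 0 w = k] \is a fin_num.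
  by apply: fin_num_measure; exact: measurable_RV_eq.
(* The default branch of [mnormalize] is excluded, since the conditioning event has positive finite
   mass. *)
rewrite /cond_law /= /mnormalize /= /mrestr setTI ifF; last first.
  by rewrite gt_eqF//= lt_eqF// -ge0_fin_numE// ltW.
rewrite /cond_prob EFinM fineK// fin_num_measure//.
by apply: measurableI; exact: measurable_RV_eq.
Qed.

End law.

(** * Moments of the chain *)

(** A barrier that grows faster than every function of quadratic growth. *)
Definition quartic {R : realType} (k : int) : R := (1 + k%:~R ^+ 2) ^+ 2.

Lemma quartic_coercive (R : realType) (eps C c : R) : 0 < eps -> 0 <= C ->
  exists K : seq int, forall k : int, k \notin K ->
    c <= eps * quartic k - C * (1 + k%:~R ^+ 2).
Proof.
move=> e0 C0.
(* With [x = k^2] the expression is [(eps (1 + x) - C) (1 + x)], which exceeds [|c|] once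
   [1 + x > r]. Since [k^2 >= |k|], this holds for [|k| >= N]. *)
pose r := (C + `|c|) / eps.
have [N rN] : exists N : nat, r < N%:R.
  by exists (Num.truncn r).+1; exact: truncnS_gt.
exists ([seq Posz i | i <- iota 0 N] ++ [seq - Posz i | i <- iota 0 N]) => k kK.
have Nk : (N <= `|k|)%N.
  rewrite leqNgt; apply/negP => kN.
  move: kK; rewrite mem_cat negb_or => /andP[/negP k1 /negP k2].
  have [k0|k0] := leP 0 k.
    by apply: k1; apply/mapP; exists `|k|%N; [rewrite mem_iota|lia].
  by apply: k2; apply/mapP; exists `|k|%N; [rewrite mem_iota|lia].
have kN : N%:R <= k%:~R ^+ 2 :> R.
  rewrite (_ : k%:~R ^+ 2 = (`|k| ^ 2)%N%:R).
    by rewrite ler_nat (leq_trans Nk)//; case: `|k|%N => // m; rewrite leq_pmulr.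
  rewrite -rmorphXn/= -abszX natr_absz ger0_norm ?sqr_ge0//.
set x := k%:~R ^+ 2 in kN *.
have rx : r < 1 + x by lra.
have : C + `|c| < eps * (1 + x) by rewrite mulrC -ltr_pdivrMr.
have : c <= `|c| := ler_norm c.
have : 0 <= `|c| := normr_ge0 c.
have x0 : 0 <= x by exact: sqr_ge0.
move=> c0 c1 h.
rewrite /quartic -/x expr2 mulrA -mulrBl.
nra.
Qed.

Section partial_expectations.
Variables (R : realType) (a1 a2 b1 b2 : R) (p : int -> int -> R -> R).
Hypotheses (ha1 : 0 < a1) (ha2 : 0 < a2) (hb1 : 0 < b1) (hb2 : 0 < b2).
Hypotheses (hp : is_transition_function p)
  (hg : has_generator p (alternating_generator a1 a2 b1 b2)).

Local Notation G := (gen a1 a2 b1 b2).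

Lemma gen_sum (s : seq int) (f : int -> int -> R) (x : int -> R) k :
  G (fun m => \sum_(n <- s) f m n * x n) k = \sum_(n <- s) G (f ^~ n) k * x n.
Proof.
rewrite /gen -!sumrB !mulr_sumr -big_split/=.
by apply: eq_bigr => n _; ring.
Qed.

(** The minimum principle applies to [w] minus the partial sum: both sides obey the backward
    equation or inequality, and at time 0 the sum is [F j] or 0. *)
Lemma partial_expectation_le (w Dw : int -> R -> R) (F : int -> R) :
  (forall k t, has_derivative (w k) t (Dw k t)) ->
  (forall k (t : R), 0 <= t -> G (w ^~ t) k <= Dw k t) ->
  (forall k, 0 <= F k <= w k 0) ->
  (forall T c : R, exists K : seq int, forall k t, k \notin K -> 0 <= t <= T ->
    c <= w k t) ->
  forall (s : seq int) k (t : R), uniq s -> 0 <= t ->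
    \sum_(n <- s) p k n t * F n <= w k t.
Proof.
move=> wD Dw_ge Fw wK s k t us t0; rewrite -subr_ge0.
(* Since [p <= 1], the sum of the [F n] bounds the partial expectation at all times, so [w]
   dominates it off [K]. *)
have [K hK] := wK t (\sum_(n <- s) F n).
have [p_ge0 _ p0 _] := hp.
apply: (@supersolution_ge0 R a1 a2 b1 b2 t K
  (fun k t => w k t - \sum_(n <- s) p k n t * F n)
  (fun k t => Dw k t - \sum_(n <- s) G (fun m => p m n t) k * F n));
  rewrite ?lexx ?t0 //; try exact: ltW.
- move=> j u jK u0t; have /andP[u0 _] := u0t; rewrite subr_ge0.
  apply: le_trans (hK _ _ jK u0t); apply: ler_sum => n _.
  rewrite ler_piMl//; first by case/andP: (Fw n).
  by have := @sum_transition_le1 _ _ hp [:: n] j u isT u0; rewrite big_seq1.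
- move=> j; rewrite subr_ge0.
  under eq_bigr do rewrite p0.
  have /andP[Fj0 Fjw] := Fw j.
  have [js|js] := boolP (j \in s).
    rewrite (bigD1_seq j)//= eqxx mul1r big1 ?addr0// => i /negbTE.
    by rewrite eq_sym => ->; rewrite mul0r.
  rewrite big1_seq ?(le_trans Fj0)// => i /= si.
  by case: eqP => [ji|]; [rewrite ji si in js|rewrite mul0r].
- move=> j u u0; apply: cvgB; first exact: has_derivative_left_continuous (wD _ _).
  apply: cvg_big => [|n _]; first exact: add_continuous.
  apply: cvgM; last exact: cvg_cst.
  exact: (transition_left_continuous hp hg).
- move=> j u u0.
  have : (w j (u + e) - w j u) / e - \sum_(n <- s) ((p j n (u + e) - p j n u) / e * F n)
    @[e --> 0^'+] --> Dw j u - \sum_(n <- s) G (fun m => p m n u) j * F n.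
    apply: cvgB; first exact: has_derivative_right.
    apply: cvg_big => [|n _]; first exact: add_continuous.
    by apply: cvgM; [exact: (transition_derivative hp hg)|exact: cvg_cst].
  apply: cvg_trans; apply: near_eq_cvg; near=> e.
  under eq_bigr do rewrite mulrAC mulrBl.
  rewrite -mulr_suml sumrB; ring.
- move=> j u u0.
  rewrite -gen_sum; have := Dw_ge j u u0; rewrite /gen; lra.
Unshelve. all: by end_near. Qed.

End partial_expectations.

(** * From partial sums to integrals of solutions *)

Section expectations.
Variables (R : realType) (a1 a2 b1 b2 : R) (p : int -> int -> R -> R).
Hypotheses (ha1 : 0 < a1) (ha2 : 0 < a2) (hb1 : 0 < b1) (hb2 : 0 < b2).
Hypotheses (hp : is_transition_function p)
  (hg : has_generator p (alternating_generator a1 a2 b1 b2)).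

Local Notation G := (gen a1 a2 b1 b2).

(* [1 + (k +- 1)^2 <= 3 (1 + k^2)], whence the factor [3^2 - 1]. *)
Let r := 8 * (a1 + a2 + b1 + b2).

Lemma sqr_le_quartic (k : int) : 1 + k%:~R ^+ 2 <= quartic k :> R.
Proof. by rewrite /quartic; have := sqr_ge0 (k%:~R : R); nra. Qed.

Lemma gen_quartic_le k : G quartic k <= r * quartic k.
Proof.
rewrite /gen /quartic !intrD mulrN1z mulr1z; set x : R := k%:~R.
have q_ge1 : 1 <= 1 + x ^+ 2 by rewrite lerDl sqr_ge0.
have bound y : 0 <= y <= 3 * (1 + x ^+ 2) ->
    y ^+ 2 - (1 + x ^+ 2) ^+ 2 <= 8 * (1 + x ^+ 2) ^+ 2.
  by move=> /andP[y0 yx]; nra.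
have up : (1 + (x + 1) ^+ 2) ^+ 2 - (1 + x ^+ 2) ^+ 2 <= 8 * (1 + x ^+ 2) ^+ 2.
  by apply: bound; nra.
have down : (1 + (x - 1) ^+ 2) ^+ 2 - (1 + x ^+ 2) ^+ 2 <= 8 * (1 + x ^+ 2) ^+ 2.
  by apply: bound; nra.
have q0 : 0 <= (1 + x ^+ 2) ^+ 2 by exact: sqr_ge0.
rewrite /r; case: ifPn => _.
all: match goal with |- is_true (?u * _ + ?v * _ <= _) =>
  apply: (@le_trans _ _ (u * (8 * (1 + x ^+ 2) ^+ 2) + v * (8 * (1 + x ^+ 2) ^+ 2))) end.
all: try by apply: lerD; rewrite ler_pM2l.
all: rewrite -mulrDl mulrA (mulrC _ 8) ler_wpM2r//; move: ha1 ha2 hb1 hb2; lra.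
Qed.

Definition quadratically_bounded (M : int -> R -> R) : Prop :=
  forall T : R, exists2 C : R, 0 <= C & forall k t, 0 <= t <= T ->
    `|M k t| <= C * (1 + k%:~R ^+ 2).

Variables (d : measure_display) (T : measurableType d)
  (mu : probability T R) (Y : T -> int) (k : int) (t : R).
Hypotheses (mY : measurable_fun [set: T] Y) (t_ge0 : 0 <= t)
  (lawY : forall n, mu [set w | Y w = n] = (p k n t)%:E).

Lemma expectation_le (w Dw : int -> R -> R) (F : int -> R) :
  (forall j u, has_derivative (w j) u (Dw j u)) ->
  (forall j (u : R), 0 <= u -> G (w ^~ u) j <= Dw j u) ->
  (forall j, 0 <= F j <= w j 0) ->
  (forall T c : R, exists K : seq int, forall j u, j \notin K -> 0 <= u <= T ->
    c <= w j u) ->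
  (\int[mu]_x (F (Y x))%:E <= (w k t)%:E)%E.
Proof.
move=> wD Dw_ge Fw wK.
apply: (integral_discrete_le mY (q := fun n => p k n t)) => //.
- by move=> n; case/andP: (Fw n).
- move=> s us; exact: (partial_expectation_le ha1 ha2 hb1 hb2 hp hg wD).
Qed.

(** The growth factor makes the barrier a supersolution; it also bounds the integral of [quartic],
    hence gives integrability of functions of quadratic growth. *)
Let W (j : int) (u : R) := quartic j * expR (r * u).

Let W_derivative j u : has_derivative (W j) u (r * W j u).
Proof.
eapply has_derivative_eq; first by derivative_rules.
by rewrite /W; ring.
Qed.

Let gen_W_le j u : G (W ^~ u) j <= r * W j u.
Proof.
have := gen_quartic_le j; rewrite -(ler_pM2r (expR_gt0 (r * u))).
rewrite /gen /W; lra.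
Qed.

Let quartic_le_W j (u : R) : 0 <= u -> quartic j <= W j u.
Proof.
move=> u0; rewrite ler_peMr ?sqr_ge0// -expR0 ler_expR mulr_ge0//.
by rewrite mulr_ge0// !addr_ge0// ltW.
Qed.

Lemma measurable_comp_int (f : int -> R) : measurable_fun [set: T] (EFin \o (f \o Y)).
Proof.
by apply/measurable_EFinP; apply: (measurableT_comp (f := f)) => // _ B _.
Qed.

Lemma integral_quartic_le : (\int[mu]_x (quartic (Y x))%:E <= (W k t)%:E)%E.
Proof.
apply: (@expectation_le W (fun j u => r * W j u)) => //.
- by move=> j; rewrite sqr_ge0 quartic_le_W.
- move=> T0 c; have [K hK] := quartic_coercive c ltr01 (lexx 0).
  exists K => j u jK /andP[u0 _].
  by have := hK j jK; rewrite mul1r mul0r subr0 => /le_trans -> //; exact: quartic_le_W.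
Qed.

Lemma quartic_integrable : mu.-integrable [set: T] (EFin \o (quartic \o Y)).
Proof.
apply/integrableP; split; first exact: measurable_comp_int.
under eq_integral => x _ do rewrite /= ger0_norm ?sqr_ge0//.
exact: le_lt_trans integral_quartic_le (ltry _).
Qed.

Lemma quadratic_integrable (f : int -> R) (C : R) :
  (forall j, `|f j| <= C * (1 + j%:~R ^+ 2)) ->
  mu.-integrable [set: T] (EFin \o (f \o Y)).
Proof.
move=> fC.
have C0 : 0 <= C.
  by have := le_trans (normr_ge0 _) (fC 0); rewrite expr0n addr0 mulr1.
apply: (@le_integrable _ _ _ mu _ measurableT _ (fun x => C%:E * (quartic (Y x))%:E)%E).
- exact: measurable_comp_int.
- move=> x _ /=; rewrite lee_fin (le_trans (fC _))//.
  by rewrite (le_trans _ (ler_norm _))// ler_wpM2l// sqr_le_quartic.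
- by apply: integrableZl => //; exact: quartic_integrable.
Qed.

(** [M] need be neither nonnegative nor coercive, so the comparison uses [eps * W + M + c0]; the
    constant cancels at the end and [eps * W k t] is an arbitrarily small error. *)
Lemma integral_le_solution (M : int -> R -> R) :
  (forall j u, has_derivative (M j) u (G (M ^~ u) j)) ->
  quadratically_bounded M ->
  (\int[mu]_x (M (Y x) 0)%:E <= (M k t)%:E)%E.
Proof.
move=> MD MC.
have [C0 C0_ge0 hC0] := MC 0.
have hf j : `|M j 0| <= C0 * (1 + j%:~R ^+ 2) by apply: hC0; rewrite lexx.
have If := quadratic_integrable hf.
have IV := quartic_integrable.
pose V := fine (\int[mu]_x (quartic (Y x))%:E).
have VE : (\int[mu]_x (quartic (Y x))%:E = V%:E)%E by rewrite fineK// integrable_fin_num.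
have V0 : 0 <= V by rewrite fine_ge0// integral_ge0// => x _; rewrite lee_fin sqr_ge0.
have fE := fineK (integrable_fin_num measurableT If).
rewrite /= in fE; rewrite -fE lee_fin; set m := fine _ in fE *.
apply/ler_addgt0Pr => e e0.
have W0 : 0 < W k t by rewrite mulr_gt0 ?expR_gt0// exprn_gt0// ltr_wpDr// sqr_ge0.
pose eps := e / W k t.
have eps0 : 0 < eps by rewrite divr_gt0.
(* Chosen so that [eps q^2 - C0 q + c0 >= 0] for [q = 1 + j^2], by completing the square; the
   initial function is then nonnegative. *)
pose c0 := C0 ^+ 2 / eps.
have ceps : c0 * eps = C0 ^+ 2 by rewrite divfK// gt_eqF.
have c00 : 0 <= c0 by rewrite divr_ge0 ?sqr_ge0// ltW.
pose w j u := eps * W j u + (M j u + c0).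
have : (\int[mu]_x (eps * quartic (Y x) + (M (Y x) 0 + c0))%:E <= (w k t)%:E)%E.
  apply: (@expectation_le w (fun j u => eps * (r * W j u) + G (M ^~ u) j)
    (fun j => eps * quartic j + (M j 0 + c0))).
  - move=> j u; eapply has_derivative_eq.
      apply: has_derivativeD.
        by apply: has_derivativeM; [exact: has_derivative_cst|exact: W_derivative].
      by apply: has_derivativeD; [exact: MD|exact: has_derivative_cst].
    by rewrite /=; ring.
  - move=> j u u0; have := gen_W_le j u; rewrite -(ler_pM2l eps0) /gen /w; lra.
  - move=> j; rewrite /w lerD2r ler_pM2l// quartic_le_W// andbT.
    have := hf j; rewrite ler_norml => /andP[+ _]; rewrite /quartic.
    set q := 1 + _; move=> h.
    have q0 : 0 <= q by rewrite addr_ge0// sqr_ge0.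
    have : 0 <= eps * q ^+ 2 - C0 * q + c0; last by lra.
    rewrite -(pmulr_rge0 _ eps0).
    have -> : eps * (eps * q ^+ 2 - C0 * q + c0) =
      (eps * q - C0 / 2) ^+ 2 + (c0 * eps - C0 ^+ 2 / 4) by field.
    by rewrite ceps addr_ge0 ?sqr_ge0//; have := sqr_ge0 C0; lra.
  - move=> T0 c; have [C C_ge0 hC] := MC T0.
    have [K hK] := quartic_coercive c eps0 C_ge0.
    exists K => j u jK u0; have := hK j jK.
    have := hC j u u0; rewrite ler_norml => /andP[+ _].
    have /andP[u00 _] := u0; have := quartic_le_W j u00.
    by rewrite -(ler_pM2l eps0) /w /quartic; lra.
have -> : (\int[mu]_x (eps * quartic (Y x) + (M (Y x) 0 + c0))%:E =
   (eps * V + (m + c0))%:E)%E.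
  under eq_integral do rewrite !EFinD EFinM.
  rewrite integralD//=; last 2 first.
  - exact: integrableZl.
  - by apply: integrableD => //; exact: finite_measure_integrable_cst.
  rewrite integralZl//= VE integralD//=; last exact: finite_measure_integrable_cst.
  by rewrite -fE integral_cst//= probability_setT mule1 !EFinD EFinM.
(* Dropping [eps * V >= 0] and cancelling [c0] leaves [m <= M k t + e]. *)
rewrite lee_fin /w => h.
have : eps * W k t = e by rewrite divfK// gt_eqF.
have : 0 <= eps * V by rewrite mulr_ge0// ltW.
lra.
Qed.

(** The equation is linear and the growth condition symmetric, so the upper bound for [- M] is the
    missing lower bound. *)
Lemma integral_solution (M : int -> R -> R) :
  (forall j u, has_derivative (M j) u (G (M ^~ u) j)) ->
  quadratically_bounded M ->
  (\int[mu]_x (M (Y x) 0)%:E = (M k t)%:E)%E.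
Proof.
move=> MD MC; apply/eqP; rewrite eq_le integral_le_solution//=.
have : (\int[mu]_x (- M (Y x) 0)%:E <= (- M k t)%:E)%E.
  apply: (@integral_le_solution (fun j u => - M j u)).
  - move=> j u; eapply has_derivative_eq.
      by apply: has_derivativeN; exact: MD.
    by rewrite /gen; ring.
  - move=> T0; have [C C0 hC] := MC T0.
    by exists C => // j u u0; rewrite normrN; exact: hC.
have [C0 _ hC0] := MC 0.
have If : mu.-integrable [set: T] (fun x => (M (Y x) 0)%:E).
  by apply: (@quadratic_integrable (M ^~ 0) C0) => j; apply: hC0; rewrite lexx.
under eq_integral do rewrite EFinN.
rewrite integralN; last exact: (integrable_add_def measurableT If).
by rewrite EFinN leeN2.
Qed.

End expectations.

(** * Quadratic growth of the explicit solutions *)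

Lemma has_derivative_bounded (R : realType) (f Df : R -> R) (T : R) :
  (forall t, has_derivative f t (Df t)) ->
  exists2 C : R, 0 <= C & forall t, 0 <= t <= T -> `|f t| <= C.
Proof.
move=> fD; have [T0|T0] := ltP T 0.
  exists 0 => // t /andP[t0 tT].
  by have := le_lt_trans (le_trans t0 tT) T0; rewrite ltxx.
have cf : {within `[0, T], continuous (fun t => `|f t|)}.
  apply: continuous_subspaceT => t; apply: cvg_norm.
  have [df _] := fD t.
  exact/differentiable_continuous/derivable1_diffP.
have [c _ hc] := EVT_max T0 cf.
by exists `|f c| => // t tT; apply: hc; rewrite in_itv/= tT.
Qed.

Section solutions_bounded.
Variables (R : realType) (a1 a2 b1 b2 : R).
Hypotheses (ha1 : 0 < a1) (ha2 : 0 < a2) (hb1 : 0 < b1) (hb2 : 0 < b2).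

Let S0 : a1 + a2 + b1 + b2 != 0. Proof. by rewrite gt_eqF// !addr_gt0. Qed.
Let S0' : b1 + b2 + a1 + a2 != 0. Proof. by rewrite gt_eqF// !addr_gt0. Qed.

Lemma parity_bounded (f g Df Dg : R -> R) (T : R) :
  (forall t, has_derivative f t (Df t)) -> (forall t, has_derivative g t (Dg t)) ->
  exists2 C : R, 0 <= C & forall (k : int) t, 0 <= t <= T ->
    `|if evenz k then f t else g t| <= C.
Proof.
move=> /(has_derivative_bounded T)[C C0 hC] /(has_derivative_bounded T)[D D0 hD].
exists (C + D); first exact: addr_ge0.
move=> k t tT; case: ifPn => _.
  by rewrite (le_trans (hC _ tT))// lerDl.
by rewrite (le_trans (hD _ tT))// lerDr.
Qed.

Lemma mean_solution_bounded : quadratically_bounded (mean_solution a1 a2 b1 b2).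
Proof.
move=> T; have [C C0 hC] := parity_bounded T
  (fun t => derivative_mean_shift t S0) (fun t => derivative_mean_shift t S0').
exists (1 + C) => [|k t tT]; first exact: addr_ge0.
rewrite /mean_solution (le_trans (ler_normD _ _))//.
have := hC k t tT; set y := `| if _ then _ else _ | => yC.
(* With [x = |k|], the bound [x + C <= (1 + C) (1 + x^2)] follows from [(x - 1)^2 >= 0], [x >= 0]
   and [C x^2 >= 0]. *)
rewrite -(real_normK (num_real (k%:~R : R))).
set x := `|_%:~R|; have : 0 <= x by exact: normr_ge0.
have := mulr_ge0 C0 (sqr_ge0 x); have := sqr_ge0 (x - 1); lra.
Qed.

Lemma square_solution_bounded x : quadratically_bounded (square_solution a1 a2 b1 b2 x).
Proof.
move=> T; have [C C0 hC] := parity_bounded T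
  (fun t => derivative_mean_shift t S0) (fun t => derivative_mean_shift t S0').
have [D D0 hD] := parity_bounded T
  (fun t => derivative_var t ha1 ha2 hb1 hb2)
  (fun t => derivative_var t hb1 hb2 ha1 ha2).
exists (2 + 4 * C ^+ 2 + 4 * x ^+ 2 + D) => [|k t tT].
  by have := sqr_ge0 C; have := sqr_ge0 x; lra.
rewrite /square_solution /mean_solution (le_trans (ler_normD _ _))//.
have := hC k t tT; have := hD k t tT.
set v := `| if _ then _ else _ |; set y := if _ then _ else _ => vD yC.
rewrite ger0_norm ?sqr_ge0//; set z := k%:~R.
have : y ^+ 2 <= C ^+ 2 by rewrite -ler_sqrt ?sqr_ge0// !sqrtr_sqr (ger0_norm C0).
have : (z + y - x) ^+ 2 <= 2 * z ^+ 2 + 4 * y ^+ 2 + 4 * x ^+ 2.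
  by have := sqr_ge0 (z - (y - x)); have := sqr_ge0 (y + x); lra.
have : 0 <= (4 * C ^+ 2 + 4 * x ^+ 2 + D) * z ^+ 2.
  rewrite mulr_ge0 ?sqr_ge0//.
  by have := sqr_ge0 C; have := sqr_ge0 x; lra.
lra.
Qed.

End solutions_bounded.

(** * Conditional mean and variance of the chain *)

Theorem proposition3p2 (R : realType) (a1 a2 b1 b2 : R)
    (ha1 : 0 < a1) (ha2 : 0 < a2) (hb1 : 0 < b1) (hb2 : 0 < b2)
    (d : measure_display) (T : measurableType d) (P : probability T R)
    (X : R -> {RV P >-> int}) (p : int -> int -> R -> R)
    (hp : is_transition_function p)
    (hg : has_generator p (alternating_generator a1 a2 b1 b2))
    (hX : is_markov_chain X p) :
  [/\ forall (k : int) (t : R), 0 <= t -> (0 < P [set w | X 0%R w = k])%E ->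
        ('E_(cond_law (X 0%R) k)[(fun w => (X t w)%:~R)%R]
         = (mean_formula a1 a2 b1 b2 k t)%:E)%E,
      forall k : int,
        ((fun z => c a1 a2 b1 b2 k z / h a1 a2 b1 b2 z)^`())%classic 1 =
        if evenz k
        then 2 * (a1 + a2) * (a1 - a2 - b1 + b2) / (a1 + a2 + b1 + b2) ^+ 2
        else 2 * (b1 + b2) * (b1 - b2 - a1 + a2) / (a1 + a2 + b1 + b2) ^+ 2,
      forall (k : int) (t : R), evenz k ->
        0 <= t -> (0 < P [set w | X 0%R w = k])%E ->
        ('V_(cond_law (X 0%R) k)[(fun w => (X t w)%:~R)%R]
         = (var_formula a1 a2 b1 b2 t)%:E)%E,
      forall (k : int) (t : R), ~~ evenz k ->
        0 <= t -> (0 < P [set w | X 0%R w = k])%E ->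
        ('V_(cond_law (X 0%R) k)[(fun w => (X t w)%:~R)%R]
         = (var_formula b1 b2 a1 a2 t)%:E)%E
    & ((Lambda b1 b2 a1 a2)^`(2))%classic 0
      = ((Lambda a1 a2 b1 b2)^`(2))%classic 0].
Proof.
have moment (M : int -> R -> R) (k : int) (t : R) :
    0 <= t -> (0 < P [set w | X 0%R w = k])%E ->
    (forall j u, has_derivative (M j) u (gen a1 a2 b1 b2 (M ^~ u) j)) ->
    quadratically_bounded M ->
    (\int[cond_law (X 0%R) k]_w (M (X t w) 0%R)%:E = (M k t)%:E)%E.
  move=> t0 Pk; apply: (integral_solution ha1 ha2 hb1 hb2 hp hg) => // n.
  exact: cond_law_transition.
have meanE (k : int) (t : R) : 0 <= t -> (0 < P [set w | X 0%R w = k])%E ->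
    ('E_(cond_law (X 0%R) k)[(fun w => (X t w)%:~R)%R]
      = (mean_solution a1 a2 b1 b2 k t)%:E)%E.
  move=> t0 Pk; rewrite unlock -moment//.
  - by apply: eq_integral => w _; rewrite mean_solution0.
  - by move=> j u; exact: derivative_mean_solution.
  - exact: mean_solution_bounded.
have varE (k : int) (t : R) : 0 <= t -> (0 < P [set w | X 0%R w = k])%E ->
    ('V_(cond_law (X 0%R) k)[(fun w => (X t w)%:~R)%R]
      = (if evenz k then var_formula a1 a2 b1 b2 t else var_formula b1 b2 a1 a2 t)%:E)%E.
  move=> t0 Pk; set m := mean_solution a1 a2 b1 b2 k t.
  rewrite /variance unlock meanE//= -/m unlock.
  (* The variance is the integral of [(X t - m)^2], the initial value of the solution centred at
     [m]; at [(k, t)] its square term vanishes. *)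
  transitivity (square_solution a1 a2 b1 b2 m k t)%:E.
    rewrite -moment//.
    - by apply: eq_integral => w _; rewrite square_solution0.
    - by move=> j u; exact: derivative_square_solution.
    - exact: square_solution_bounded.
  by rewrite /square_solution subrr expr0n add0r.
split.
- by move=> k t t0 Pk; rewrite meanE// mean_formulaE.
- by move=> k; exact: derive1_c_div_h.
- by move=> k t ek t0 Pk; rewrite varE// ek.
- by move=> k t /negbTE ek t0 Pk; rewrite varE// ek.
- rewrite !derive2_Lambda0//.
  have S0 : a1 + a2 + b1 + b2 != 0 by rewrite gt_eqF// !addr_gt0.
  rewrite (_ : b1 + b2 + a1 + a2 = a1 + a2 + b1 + b2); last by ring.
  by field.
Qed.
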